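(* A diffeological vector space $V$ is fine if and only if $L^\infty(V,\mathbb{R})=L(V,\mathbb{R})$, i.e., if and only if every linear functional $V\to\mathbb{R}$ is smooth.
   Context: A diffeological space is a set $X$ together with a specified set of functions $U\to X$ (called plots) for each open set $U\subseteq\mathbb{R}^n$ and each $n\in\mathbb{N}$, such that: (1) every constant function $U\to X$ is a plot; (2) if $U\to X$ is a plot and $V\to U$ is smooth ($V$ open in some $\mathbb{R}^m$), then the composite $V\to U\to X$ is a plot; (3) if $U=\bigcup_i U_i$ is an open cover and $U\to X$ is a function each of whose restrictions $U_i\to X$ is a plot, then $U\to X$ is a plot. A function $f:X\to Y$ between diffeological spaces is smooth if $f\circ p$ is a plot of $Y$ for every plot $p$ of $X$. $\mathbb{R}^n$ carries the standard diffeology (plots are the usual smooth maps). Products carry the product diffeology (plots are the functions all of whose components are plots). A diffeological vector space is a real vector space $V$ with a diffeology such that addition $V\times V\to V$ and scalar multiplication $\mathbb{R}\times V\to V$ are smooth. $V$ is fine if its diffeology is the smallest (fewest plots) diffeology making the vector space $V$ a diffeological vector space. $L(V,\mathbb{R})$ is the set of all linear maps $V\to\mathbb{R}$, and $L^\infty(V,\mathbb{R})$ is the set of all smooth linear maps $V\to\mathbb{R}$. *)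

(* Defs.v *)
From HB Require Import structures.
From mathcomp Require Import all_boot all_order all_algebra.
From mathcomp Require Import all_classical all_reals all_analysis.

Set Implicit Arguments.
Unset Strict Implicit.
Unset Printing Implicit Defensive.

Import Order.TTheory GRing.Theory Num.Theory.
Import numFieldNormedType.Exports.

Local Open Scope classical_set_scope.
Local Open Scope ring_scope.

Lemma near_eq_differentiable (R : numFieldType) (V W : normedModType R)
    (f g : V -> W) (x : V) :
  (\near x, f x = g x) -> differentiable f x -> differentiable g x.
Proof.
move=> fg df; have dfc := diff_continuous df.
have fgx : f x = g x by exact: nbhs_singleton fg.
have dg : g \o shift x = cst (g x) + 'd f x +o_ 0 id.
  apply/eqaddoP => _/posnumP[e].
  have /eqaddoP/(_ e%:num (gt0 e)) := diff_locally df.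
  have fg0 : \forall h \near (0 : V), f (h + x) = g (h + x).
    by move: fg; rewrite (near_shift 0) subr0.
  apply: filterS2 fg0 => h fgh.
  by rewrite !fctE /= fgh fgx.
have dgE := diff_unique dfc dg.
by apply/diff_locallyP; rewrite dgE; split.
Qed.

Section Ck.
Variables (R : realType) (n : nat).
Implicit Types (U V : set 'rV[R]_n) (f g : 'rV[R]_n -> R).

(* f is C^(k+1) on U iff it is Frechet differentiable at the points of U and
   its differential x |-> 'd f x is C^k, i.e. every x |-> 'D_v f x = 'd f x v
   is. Meant for U open, in which case only the values of f on U matter. *)
Fixpoint Ck (k : nat) U f : Prop :=
  if k is k'.+1 then
    {in U, forall x, differentiable f x} /\ forall v, Ck k' U ('D_v f)
  else {in U, continuous f}.

Definition smooth_on U f : Prop := forall k, Ck k U f.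

Lemma eq_on_near U f g x : open U -> U x -> {in U, f =1 g} ->
  \near x, f x = g x.
Proof.
move=> oU Ux fg; have : nbhs x U by apply: open_nbhs_nbhs; split.
by apply: filterS => y Uy; apply: fg; rewrite inE.
Qed.

Lemma eq_Ck k U f g : open U -> {in U, f =1 g} -> Ck k U f -> Ck k U g.
Proof.
move=> oU; elim: k f g => [|k IHk] f g fg /=.
  move=> cf x xU; have Ux : U x by rewrite inE in xU.
  have nfg := eq_on_near oU Ux fg.
  have fgx : f x = g x by exact: fg.
  rewrite /continuous_at -fgx; apply: cvg_trans (cf x xU).
  exact: near_eq_cvg nfg.
move=> [df Df]; split=> [x xU|v].
  have Ux : U x by rewrite inE in xU.
  exact: near_eq_differentiable (eq_on_near oU Ux fg) (df x xU).
apply: IHk (Df v) => x xU; have Ux : U x by rewrite inE in xU.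
exact: near_eq_derive (eq_on_near oU Ux fg).
Qed.

Lemma CkS k U f : Ck k.+1 U f -> Ck k U f.
Proof.
elim: k f => [|k IHk] f /= [df Df].
  by move=> x /df; exact: differentiable_continuous.
by split=> // v; apply/IHk/Df.
Qed.

Lemma Ck_cst k U (c : R) : Ck k U (cst c).
Proof.
elim: k c => [|k IHk] c /=; first by move=> x _; exact: cst_continuous.
split=> [x _|v]; first exact: differentiable_cst.
by rewrite (_ : 'D_v _ = cst 0) //; apply/funext => x; rewrite derive_cst.
Qed.

Lemma CkD k U f g : open U -> Ck k U f -> Ck k U g -> Ck k U (f + g).
Proof.
move=> oU; elim: k f g => [|k IHk] f g /=.
  by move=> cf cg x xU; apply: continuousD; [apply: cf | apply: cg].
move=> [df Df] [dg Dg]; split=> [x xU|v].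
  by apply: differentiableD; [exact: df | exact: dg].
apply: eq_Ck (IHk _ _ (Df v) (Dg v)) => // x xU.
by rewrite deriveD //; apply: diff_derivable; [exact: df | exact: dg].
Qed.

Lemma CkM k U f g : open U -> Ck k U f -> Ck k U g -> Ck k U (f * g).
Proof.
move=> oU; elim: k f g => [|k IHk] f g.
  by move=> cf cg x xU; apply: continuousM; [apply: cf | apply: cg].
move=> Cf Cg; have [df Df] := Cf; have [dg Dg] := Cg; split=> [x xU|v].
  by apply: differentiableM; [exact: df | exact: dg].
apply: (@eq_Ck _ _ (f * 'D_v g + g * 'D_v f)) => //.
  move=> x xU.
  by rewrite deriveM //; apply: diff_derivable; [exact: df | exact: dg].
by apply: CkD => //; apply: IHk; [exact: CkS | exact: Dg | exact: CkS | exact: Df].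
Qed.

Lemma Ck_sum k U (I : Type) (r : seq I) (F : I -> 'rV[R]_n -> R) : open U ->
  (forall i, Ck k U (F i)) -> Ck k U (fun x => \sum_(i <- r) F i x).
Proof.
move=> oU CF; elim: r => [|i r IHr].
  by rewrite (_ : (fun _ => _) = cst 0) ?funeqE => [|x];
    [exact: Ck_cst | rewrite big_nil].
rewrite (_ : (fun _ => _) = F i + (fun x => \sum_(j <- r) F j x)).
  exact: CkD.
by apply/funext => x; rewrite big_cons.
Qed.

Lemma Ck_bigcup k (I : Type) (U_ : I -> set 'rV[R]_n) f :
  (forall i, Ck k (U_ i) f) -> Ck k (\bigcup_i U_ i) f.
Proof.
elim: k f => [|k IHk] f /= Cf.
  by move=> x /[!inE] -[i _ Uix]; apply: (Cf i); rewrite inE.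
split=> [x /[!inE] -[i _ Uix]|v].
  by apply: (Cf i).1; rewrite inE.
by apply: IHk => i; exact: (Cf i).2.
Qed.

End Ck.

Section SmoothComposition.
Variables (R : realType) (m n : nat).

Definition smooth_map_on (U : set 'rV[R]_m) (g : 'rV[R]_m -> 'rV[R]_n) : Prop :=
  forall j, smooth_on U (fun x => g x 0 j).

Lemma row_components (g : 'rV[R]_m -> 'rV[R]_n) :
  g = \sum_j (fun x => g x 0 j *: delta_mx 0 j).
Proof.
by apply/funext => x; rewrite fct_sumE [LHS]row_sum_delta.
Qed.

Lemma differentiable_row (g : 'rV[R]_m -> 'rV[R]_n) x :
  (forall j, differentiable (fun x => g x 0 j) x) -> differentiable g x.
Proof.
move=> dg; rewrite [g]row_components; apply: differentiable_sum => j.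
exact: differentiableZl.
Qed.

Lemma derive_row (g : 'rV[R]_m -> 'rV[R]_n) x v j : differentiable g x ->
  'D_v (fun x => g x 0 j) x = 'D_v g x 0 j.
Proof.
move=> dg.
have /(congr1 (fun M : 'rV_n => M 0 j)) := derive_mx (@diff_derivable _ _ _ g x v dg).
by rewrite mxE.
Qed.

Lemma continuous_row (g : 'rV[R]_m -> 'rV[R]_n) (x : 'rV[R]_m) :
  (forall j, {for x, continuous (fun y : 'rV[R]_m => g y 0 j)}) ->
  {for x, continuous g}.
Proof.
move=> cg; rewrite [g]row_components.
elim/big_ind: _ => [|f h cf ch|j _]; first exact: cst_continuous.
  exact: continuousD.
exact: (@cvgZr_tmp R 'rV[R]_n _ (nbhs x) _ (fun y : 'rV[R]_m => g y 0 j)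
  _ _ (cg j)).
Qed.

Lemma Ck_comp k (V : set 'rV[R]_m) (U : set 'rV[R]_n)
    (g : 'rV[R]_m -> 'rV[R]_n) (f : 'rV[R]_n -> R) : open V ->
  (forall j, Ck k V (fun x => g x 0 j)) -> {homo g : x / V x >-> U x} ->
  Ck k U f -> Ck k V (f \o g).
Proof.
move=> oV + gVU; elim: k f => [|k IHk] f Cg.
  move=> cf x xV; apply: continuous_comp.
    by apply: continuous_row => j; exact: Cg.
  by apply: cf; move: xV; rewrite !inE; exact: gVU.
move=> [df Df].
have dg x : x \in V -> differentiable g x.
  by move=> xV; apply: differentiable_row => j; apply: (Cg j).1.
have dfg x : x \in V -> differentiable f (g x).
  by move=> xV; apply: df; move: xV; rewrite !inE; exact: gVU.
split=> [x xV|v]; first by apply: differentiable_comp; [exact: dg | exact: dfg].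
apply: (@eq_Ck _ _ _ _ (fun x => \sum_j
  ('D_v (fun x => g x 0 j) * ('D_(delta_mx 0 j) f \o g)) x)) => //.
  move=> x xV; have dgx := dg _ xV; have dfx := dfg _ xV.
  rewrite deriveE; last exact: differentiable_comp.
  rewrite diff_comp //= -(deriveE v dgx) ['D_v g x]row_sum_delta linear_sum.
  by apply: eq_bigr => j _; rewrite linearZ /= -derive_row // -deriveE //.
apply: Ck_sum => // j; apply: CkM => //; first exact: (Cg j).2.
by apply: IHk; [move=> i; exact: CkS | exact: Df].
Qed.

End SmoothComposition.

(* A plot U -> T is represented by a total function p : 'rV_n -> T, of which
   only the values on U are relevant (plot_eq). *)
Record diffeology (R : realType) (T : Type) := Diffeology {
  plot : forall n : nat, set 'rV[R]_n -> ('rV[R]_n -> T) -> Prop;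
  plot_open : forall n (U : set 'rV[R]_n) p, plot U p -> open U;
  plot_eq : forall n (U : set 'rV[R]_n) p q,
    {in U, p =1 q} -> plot U p -> plot U q;
  plot_cst : forall n (U : set 'rV[R]_n) (t : T), open U -> plot U (cst t);
  plot_comp : forall m n (V : set 'rV[R]_m) (U : set 'rV[R]_n) g p,
    open V -> smooth_map_on V g -> {homo g : x / V x >-> U x} ->
    plot U p -> plot V (p \o g);
  plot_bigcup : forall n (I : Type) (U_ : I -> set 'rV[R]_n) p,
    (forall i, open (U_ i)) -> (forall i, plot (U_ i) p) ->
    plot (\bigcup_i U_ i) p
}.

Arguments plot {R T} d {n}.

Definition smooth (R : realType) (X Y : Type) (DX : diffeology R X)
    (DY : diffeology R Y) (f : X -> Y) : Prop :=
  forall n (U : set 'rV[R]_n) p, plot DX U p -> plot DY U (f \o p).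

Definition finer (R : realType) (T : Type) (D1 D2 : diffeology R T) : Prop :=
  forall n (U : set 'rV[R]_n) p, plot D1 U p -> plot D2 U p.

Section StandardDiffeology.
Variable R : realType.

Definition std_plot n (U : set 'rV[R]_n) (p : 'rV[R]_n -> R) : Prop :=
  open U /\ smooth_on U p.

Lemma std_plot_open n (U : set 'rV[R]_n) p : std_plot U p -> open U.
Proof. by case. Qed.

Lemma std_plot_eq n (U : set 'rV[R]_n) p q :
  {in U, p =1 q} -> std_plot U p -> std_plot U q.
Proof. by move=> pq [oU sp]; split=> // k; exact: eq_Ck (sp k). Qed.

Lemma std_plot_cst n (U : set 'rV[R]_n) t : open U -> std_plot U (cst t).
Proof. by move=> oU; split=> // k; exact: Ck_cst. Qed.

Lemma std_plot_comp m n (V : set 'rV[R]_m) (U : set 'rV[R]_n) g p :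
  open V -> smooth_map_on V g -> {homo g : x / V x >-> U x} ->
  std_plot U p -> std_plot V (p \o g).
Proof.
move=> oV sg gVU [_ sp]; split=> // k.
by apply: Ck_comp gVU _ => // j; exact: sg.
Qed.

Lemma std_plot_bigcup n (I : Type) (U_ : I -> set 'rV[R]_n) p :
  (forall i, open (U_ i)) -> (forall i, std_plot (U_ i) p) ->
  std_plot (\bigcup_i U_ i) p.
Proof.
move=> oU sp; split=> [|k]; first exact: bigcup_open.
by apply: Ck_bigcup => i; exact: (sp i).2.
Qed.

Definition std_diffeology : diffeology R R :=
  Diffeology std_plot_open std_plot_eq std_plot_cst std_plot_comp
    std_plot_bigcup.

End StandardDiffeology.

Section ProductDiffeology.
Variables (R : realType) (X Y : Type).
Variables (DX : diffeology R X) (DY : diffeology R Y).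

Definition prod_plot n (U : set 'rV[R]_n) (p : 'rV[R]_n -> X * Y) : Prop :=
  plot DX U (fst \o p) /\ plot DY U (snd \o p).

Lemma prod_plot_open n (U : set 'rV[R]_n) p : prod_plot U p -> open U.
Proof. by case=> /plot_open. Qed.

Lemma prod_plot_eq n (U : set 'rV[R]_n) p q :
  {in U, p =1 q} -> prod_plot U p -> prod_plot U q.
Proof.
move=> pq [pX pY]; split; [apply: plot_eq pX | apply: plot_eq pY];
  by move=> x xU /=; rewrite pq.
Qed.

Lemma prod_plot_cst n (U : set 'rV[R]_n) t : open U -> prod_plot U (cst t).
Proof. by move=> oU; split; exact: plot_cst. Qed.

Lemma prod_plot_comp m n (V : set 'rV[R]_m) (U : set 'rV[R]_n) g p :
  open V -> smooth_map_on V g -> {homo g : x / V x >-> U x} ->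
  prod_plot U p -> prod_plot V (p \o g).
Proof.
by move=> oV sg gVU [pX pY]; split;
  [exact: plot_comp sg gVU pX | exact: plot_comp sg gVU pY].
Qed.

Lemma prod_plot_bigcup n (I : Type) (U_ : I -> set 'rV[R]_n) p :
  (forall i, open (U_ i)) -> (forall i, prod_plot (U_ i) p) ->
  prod_plot (\bigcup_i U_ i) p.
Proof. by move=> oU pU; split; apply: plot_bigcup => // i; case: (pU i). Qed.

Definition prod_diffeology : diffeology R (X * Y) :=
  Diffeology prod_plot_open prod_plot_eq prod_plot_cst prod_plot_comp
    prod_plot_bigcup.

End ProductDiffeology.

Section DiffeologicalVectorSpace.
Variables (R : realType) (V : lmodType R).

Definition vector_space_diffeology (D : diffeology R V) : Prop :=
  smooth (prod_diffeology D D) D (fun uv => uv.1 + uv.2) /\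
  smooth (prod_diffeology (std_diffeology R) D) D (fun av => av.1 *: av.2).

Definition fine_diffeology (D : diffeology R V) : Prop :=
  vector_space_diffeology D /\
  forall E : diffeology R V, vector_space_diffeology E -> finer D E.

Definition linear_functionals : set (V -> R) := [set l | scalar l].

Definition smooth_linear_functionals (D : diffeology R V) : set (V -> R) :=
  [set l | scalar l /\ smooth D (std_diffeology R) l].

End DiffeologicalVectorSpace.

Arguments linear_functionals {R} V _.

(* Main.v *)
Require Import Defs.
From HB Require Import structures.
From mathcomp Require Import all_boot all_order all_algebra.
From mathcomp Require Import all_classical all_reals all_analysis.

(** Call a map [p] into [V] a weak plot if [L \o p] is smooth for every linear
    functional [L], smooth or not. The weak plots form a diffeology, which
    depends on the vector space [V] alone. The theorem holds because this is
    the fine diffeology of [V]; by construction it is also the largest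
    diffeology for which every linear functional is smooth.

    - Addition and scalar multiplication are smooth for it because [L] turns
      them into sums and products of real smooth functions
      ([weak_vector_space_diffeology]). A fine diffeology is therefore finer
      than the weak one, so every linear functional is smooth for it.
    - Every weak plot is a plot of each vector space diffeology
      ([weak_diffeology_finer]). If all linear functionals are smooth for [D],
      the plots of [D] are weak plots, so [D] is fine.

    The second point rests on a local finiteness property
    ([weak_plot_locally_span]): near each point, a weak plot [p] takes its
    values in a finite-dimensional subspace. Otherwise there are points [y_m]
    converging to a point [x] such that the vectors [p y_m] are linearly
    independent, and a functional [L] with [L (p y_m) = m] for all [m] makes
    [L \o p] unbounded near [x], although it is continuous. Locally, then, [p]
    is a finite sum of fixed vectors with coefficients of the form [L \o p],
    which are smooth, and any vector space diffeology accepts such a sum as a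
    plot ([plot_of_weak_plot_span]).

    The functionals needed on the possibly infinite-dimensional [V] all come
    from one consequence of Zorn's lemma ([separating_functional]). *)

Set Implicit Arguments.
Unset Strict Implicit.
Unset Printing Implicit Defensive.

Import Order.TTheory GRing.Theory Num.Theory.
Import numFieldNormedType.Exports.

Local Open Scope classical_set_scope.
Local Open Scope ring_scope.

(** * Linear functionals on infinite-dimensional spaces *)

Section Subspaces.
Variables (K : fieldType) (V : lmodType K).
Implicit Types (H M : set V) (s : seq V) (a b : K) (u v w e : V).

Definition is_subspace H : Prop :=
  H 0 /\ forall a u v, H u -> H v -> H (a *: u + v).

Lemma subspaceZ H a u : is_subspace H -> H u -> H (a *: u).
Proof. by move=> [H0 HL] Hu; rewrite -[_ *: _]addr0; exact: HL. Qed.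

Lemma subspaceZ_inv H a u : is_subspace H -> a != 0 -> H (a *: u) -> H u.
Proof.
by move=> sH a0 /(subspaceZ a^-1 sH); rewrite scalerA mulVf // scale1r.
Qed.

Lemma subspaceB H u v : is_subspace H -> H u -> H v -> H (u - v).
Proof. by move=> [_ HL] Hu Hv; rewrite addrC -scaleN1r; exact: HL. Qed.

(** The sum of [H] and the line of [w], in the form that keeps the component
    along [w] explicit. *)
Definition add_line w H : set V := [set v | exists a, H (v - a *: w)].

Lemma sub_add_line w H : H `<=` add_line w H.
Proof. by move=> v Hv; exists 0; rewrite scale0r subr0. Qed.

Lemma add_line_gen w H : H 0 -> add_line w H w.
Proof. by move=> H0; exists 1; rewrite scale1r subrr. Qed.

Lemma subspace_add_line w H : is_subspace H -> is_subspace (add_line w H).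
Proof.
move=> [H0 HL]; split=> [|a u v [b Hu] [c Hv]]; first exact: sub_add_line.
exists (a * b + c).
rewrite scalerDl -scalerA opprD addrACA -scalerBr; exact: HL.
Qed.

Definition span s : set V := foldr add_line [set 0] s.

Lemma subspace_span s : is_subspace (span s).
Proof.
elim: s => [|w s IHs] /=; last exact: subspace_add_line.
by split=> // a u v -> ->; rewrite scaler0 addr0.
Qed.

(** A subspace [M] that contains [H] and is maximal among those avoiding [e] is
    a complement of the line of [e]: for [w] outside [M], the larger subspace
    [add_line w M] contains [e], and this is a relation that puts a multiple of
    [e] in the class of [w] modulo [M]. The functional is the coordinate along
    [e]. *)
Lemma separating_functional H e : is_subspace H -> ~ H e ->
  exists L : {scalar V}, (forall v, H v -> L v = 0) /\ L e = 1.
Proof.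
move=> sH He.
(* The empty set is admitted because the empty chain needs an upper bound. *)
pose P M := ~ M e /\ forall w, M w -> is_subspace M /\ H `<=` M.
have [M [[Me MP] Mmax]] : exists M, P M /\ forall N, M `<` N -> ~ P N.
  apply: Zorn_bigcup => F FP Ftot; split=> [[X /FP[]]//|w [X FX Xw]].
  have [[X0 _] HX] := (FP _ FX).2 _ Xw.
  split; last by move=> v /HX Xv; exists X.
  split=> [|a u v [Y FY Yu] [Z FZ Zv]]; first by exists X.
  have [YZ|ZY] := Ftot _ _ FY FZ.
    by exists Z => //; have [[_ +] _] := (FP _ FZ).2 _ Zv; apply=> //; exact: YZ.
  by exists Y => //; have [[_ +] _] := (FP _ FY).2 _ Yu; apply=> //; exact: ZY.
have [sM HM] : is_subspace M /\ H `<=` M.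
  suff [w /MP//] : M !=set0.
  apply: contrapT => /set0P/negP; rewrite negbK => /eqP M0.
  apply: (Mmax H); first by rewrite M0; split=> // /(_ 0); apply; exact: sH.1.
  by rewrite /P; split=> // w _; split.
have coord w : exists a, M (w - a *: e).
  have [Mw|Mw] := pselect (M w); first by exists 0; rewrite scale0r subr0.
  have [b Mb] : add_line w M e.
    apply: contrapT => Ne; apply: (Mmax (add_line w M)).
      split; first exact: sub_add_line.
      by move/(_ w (add_line_gen w sM.1)).
    split=> // _ _; split; first exact: subspace_add_line.
    by move=> v /HM; exact: sub_add_line.
  have b0 : b != 0.
    by apply: contra_notN Me => /eqP b0; move: Mb; rewrite b0 scale0r subr0.
  exists b^-1; have /(subspaceZ (- b^-1) sM) := Mb.
  by rewrite scaleNr scalerBr scalerA mulVf // scale1r opprB.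
have coord_uniq w a b : M (w - a *: e) -> M (w - b *: e) -> a = b.
  move=> Ma Mb; apply/eqP; rewrite -subr_eq0; apply: contra_notT Me => ab.
  apply: (subspaceZ_inv sM ab); have := subspaceB sM Mb Ma.
  by rewrite opprB addrC -addrA addKr scalerBl addrC.
have [l Ml] := choice coord.
have lin_l : scalar l.
  move=> a u v; apply: (coord_uniq (a *: u + v)) (Ml _) _.
  by rewrite scalerDl -scalerA opprD addrACA -scalerBr; exact: sM.2.
pose L : {scalar V} := HB.pack l (GRing.isLinear.Build K V K *%R l lin_l).
exists L; split=> [v /HM Mv|].
  by apply: (coord_uniq v) (Ml v) _; rewrite scale0r subr0.
by apply: (coord_uniq e) (Ml e) _; rewrite scale1r subrr; exact: sM.1.
Qed.

End Subspaces.

Section Interpolation.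
Variables (K : fieldType) (V : lmodType K).

Lemma span_fst (s : seq (V * K^o)) v : span s v -> span (map fst s) v.1.
Proof.
by elim: s v => [|w s IHs] v /= => [->//|[a /IHs va]]; exists a.
Qed.

(** The premise says that the [u n] are linearly independent. The prescribed
    values span a subspace [G] of the graph space [V * K]; by independence [G]
    is the graph of a function, that is, it avoids the vertical vector [(0, 1)].
    A functional that separates [(0, 1)] from [G] has [G] in its kernel, and
    solving its equation for the second coordinate gives the interpolating
    functional. *)
Lemma interpolating_functional (u : nat -> V) (c : nat -> K) :
  (forall n, ~ span [seq u i | i <- rev (iota 0 n)] (u n)) ->
  exists L : {scalar V}, forall n, L (u n) = c n.
Proof.
move=> uP; pose pts n : seq (V * K^o) := [seq (u i, c i) | i <- rev (iota 0 n)].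
have ptsS n : pts n.+1 = (u n, c n) :: pts n.
  by rewrite /pts -addn1 iotaD rev_cat.
pose G := \bigcup_n span (pts n).
have ptsD m n : span (pts n) `<=` span (pts (m + n)%N).
  elim: m => // m IHm v /IHm; rewrite addSn ptsS; exact: sub_add_line.
have sG : is_subspace G.
  split=> [|a v w [m _ mv] [n _ nw]].
    by exists 0%N => //; exact: (subspace_span _).1.
  exists (m + n)%N => //; apply: (subspace_span _).2; last exact: ptsD.
  by rewrite addnC; exact: ptsD.
have Ge : ~ G (0, 1).
  move=> [n _]; elim: n => [[] /eqP|n IHn]; first by rewrite oner_eq0.
  rewrite ptsS => -[a]; have [->|a0] := eqVneq a 0.
    by rewrite scale0r subr0.
  move=> /span_fst/= /[!sub0r] h; apply: (uP n).
  apply: (@subspaceZ_inv _ _ _ (- a)); rewrite ?oppr_eq0 //.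
    exact: subspace_span.
  by move: h; rewrite /pts -map_comp scaleNr.
have [L [LG Le]] := separating_functional sG Ge.
pose l v := - L (v, 0).
have lin_l : scalar l.
  move=> a v w; rewrite /l.
  have -> : (a *: v + w, 0) = a *: (v, 0) + (w, 0) :> V * K^o.
    by congr pair; rewrite /= scaler0 addr0.
  by rewrite linearP /= opprD mulrN.
pose L' : {scalar V} := HB.pack l (GRing.isLinear.Build K V K *%R l lin_l).
exists L' => n; rewrite /L' /= /l.
have /LG : G (u n, c n).
  by exists n.+1 => //; rewrite ptsS; apply: add_line_gen; exact: (subspace_span _).1.
have -> : (u n, c n) = c n *: (0, 1) + (u n, 0) :> V * K^o.
  by congr pair; rewrite /= ?scaler0 ?add0r // addr0 /GRing.scale /= mulr1.
by rewrite linearP /= Le mulr1 => /eqP; rewrite addr_eq0 => /eqP.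
Qed.

End Interpolation.

(** * The weak diffeology *)

Section WeakDiffeology.
Variables (R : realType) (V : lmodType R).

(** The functionals [L] range over the algebraic dual, so the notion involves no
    diffeology on [V]. *)
Definition weak_plot n (U : set 'rV[R]_n) (p : 'rV[R]_n -> V) : Prop :=
  forall L : {scalar V}, plot (std_diffeology R) U (L \o p).

Lemma weak_plot_open n (U : set 'rV[R]_n) p : weak_plot U p -> open U.
Proof. by move=> /(_ \0); exact: plot_open. Qed.

Lemma weak_plot_eq n (U : set 'rV[R]_n) p q :
  {in U, p =1 q} -> weak_plot U p -> weak_plot U q.
Proof.
by move=> pq wp L; apply: plot_eq (wp L) => x xU /=; rewrite pq.
Qed.

Lemma weak_plot_cst n (U : set 'rV[R]_n) t : open U -> weak_plot U (cst t).
Proof. by move=> oU L; exact: (plot_cst _ (L t)). Qed.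

Lemma weak_plot_comp m n (A : set 'rV[R]_m) (U : set 'rV[R]_n) g p :
  open A -> smooth_map_on A g -> {homo g : x / A x >-> U x} ->
  weak_plot U p -> weak_plot A (p \o g).
Proof. by move=> oA sg gAU wp L; exact: plot_comp sg gAU (wp L). Qed.

Lemma weak_plot_bigcup n (I : Type) (U_ : I -> set 'rV[R]_n) p :
  (forall i, open (U_ i)) -> (forall i, weak_plot (U_ i) p) ->
  weak_plot (\bigcup_i U_ i) p.
Proof. by move=> oU wp L; apply: plot_bigcup => // i; exact: wp. Qed.

Definition weak_diffeology : diffeology R V :=
  Diffeology weak_plot_open weak_plot_eq weak_plot_cst weak_plot_comp
    weak_plot_bigcup.

Lemma weak_plotD n (U : set 'rV[R]_n) p q :
  weak_plot U p -> weak_plot U q -> weak_plot U (fun x => p x + q x).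
Proof.
move=> wp wq L; have [oU sp] := wp L; have [_ sq] := wq L; split=> // k.
rewrite (_ : _ \o _ = (L \o p) + (L \o q)); first exact: CkD.
by apply/funext => x /=; rewrite raddfD.
Qed.

Lemma weak_plotZ n (U : set 'rV[R]_n) a p :
  plot (std_diffeology R) U a -> weak_plot U p ->
  weak_plot U (fun x => a x *: p x).
Proof.
move=> [_ sa] wp L; have [oU sp] := wp L; split=> // k.
rewrite (_ : _ \o _ = a * (L \o p)); first exact: CkM.
by apply/funext => x /=; rewrite linearZ.
Qed.

Lemma weak_vector_space_diffeology : vector_space_diffeology weak_diffeology.
Proof.
by split=> n U p [p1 p2]; [exact: weak_plotD p1 p2 | exact: weak_plotZ p1 p2].
Qed.

Lemma weak_plotS n (U N : set 'rV[R]_n) p : open N -> N `<=` U ->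
  weak_plot U p -> weak_plot N p.
Proof.
move=> oN NU wp L; split=> // k; have := (wp L).2 k.
elim: k (L \o p) => [|k IHk] f /=.
  by move=> cf x /[!inE] /NU Ux; apply: cf; rewrite inE.
move=> [df Df]; split=> [x /[!inE] /NU Ux|v]; first by apply: df; rewrite inE.
exact: IHk.
Qed.

(** Only the continuity of the functions [L \o p] is used: it forbids linearly
    independent values [p (y m)] at points [y m] converging to [x], since the
    values of a linear functional at such vectors can be any sequence. *)
Lemma weak_plot_locally_span n (U : set 'rV[R]_n) p x : weak_plot U p -> U x ->
  exists s, \forall y \near x, span s (p y).
Proof.
move=> wp Ux; apply: contrapT => /forallNP nospan.
have pick (sn : seq V * nat) :
    exists y, ball x sn.2.+1%:R^-1 y /\ ~ span sn.1 (p y).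
  case: sn => s m /=; apply: contrapT => /forallNP h; apply: (nospan s).
  have : nbhs x (ball x (m.+1%:R^-1 : R)) by apply: nbhsx_ballx.
  apply: filterS => y xy; apply: contrapT => spy; by apply: (h y); split.
have [f fP] := choice pick.
(* [s m] lists the vectors [p (y i)], [i < m]; the point [y m], at distance less
   than [1 / (m + 1)] from [x], is chosen outside their span. *)
pose s := fix s k := if k is m.+1 then p (f (s m, m)) :: s m else [::].
pose y m := f (s m, m).
have sE m : s m = [seq p (y i) | i <- rev (iota 0 m)].
  by elim: m => // m IHm; rewrite -addn1 iotaD rev_cat /= -IHm addn1.
have [L Ly] : exists L : {scalar V}, forall m, L (p (y m)) = m%:R.
  apply: (@interpolating_functional _ _ (p \o y)) => m.
  by rewrite -[map _ _](sE m); exact: (fP (s m, m)).2.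
have /(_ x (mem_set Ux)) cLp : {in U, continuous (L \o p)}.
  exact: ((wp L).2 0%N).
have /nbhs_ballP[e /= e0 xe] : \forall z \near x, `|L (p x) - L (p z)| < 1.
  by have /cvgrPdist_lt/(_ 1 ltr01) := cLp.
have [m [ne nL]] : exists m, m.+1%:R^-1 < e /\ L (p x) + 1 < m%:R.
  near \oo => m; exists m; split; near: m; last exact: nbhs_infty_gtr.
  exact: (near_infty_natSinv_lt (PosNum e0)).
have : `|L (p x) - L (p (y m))| < 1.
  by apply: xe; apply: le_ball (ltW ne) _ (fP (s m, m)).1.
rewrite Ly ltr_norml ltrBrDl ltrBlDr => /andP[/(lt_trans nL)].
by rewrite ltxx.
Unshelve. all: by end_near.
Qed.

(** Induction on the generators: a functional [L] that vanishes on [span s] with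
    [L u = 1] reads off the coefficient of [u], so subtracting [L (p x) *: u]
    leaves a weak plot with values in [span s]. *)
Lemma plot_of_weak_plot_span (E : diffeology R V) n (N : set 'rV[R]_n) p s :
  vector_space_diffeology E -> weak_plot N p ->
  {in N, forall x, span s (p x)} -> plot E N p.
Proof.
move=> [addE mulE]; elim: s p => [|u s IHs] p wp sp.
  apply: plot_eq (plot_cst E 0 (weak_plot_open wp)) => x xN.
  by rewrite /= (sp x xN).
have [su|su] := pselect (span s u).
  apply: IHs => // x /sp[a sa]; rewrite -(subrK (a *: u) (p x)) addrC.
  exact: (subspace_span s).2.
have [L [Ls Lu]] := separating_functional (subspace_span s) su.
pose q x := p x + L (p x) *: (- u).
have wq : weak_plot N q.
  apply: weak_plotD (wp) _; apply: weak_plotZ; first exact: wp.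
  exact: weak_plot_cst (weak_plot_open wp).
have sq : {in N, forall x, span s (q x)}.
  move=> x /sp[a sa]; rewrite /q.
  have := Ls _ sa; rewrite linearB linearZ /= Lu mulr1 => /eqP.
  by rewrite subr_eq0 => /eqP ->; rewrite scalerN.
have Eq := IHs q wq sq.
have ELu : plot E N (fun x => L (p x) *: u).
  apply: (mulE _ _ (fun x => (L (p x), u))); split; first exact: wp.
  exact: (plot_cst E u (weak_plot_open wp)).
have := addE _ _ (fun x => (L (p x) *: u, q x)) (conj ELu Eq).
apply: plot_eq => x _ /=.
by rewrite /q scalerN addrC subrK.
Qed.

(** Being a plot is a local property, so it is enough to treat neighbourhoods on
    which a weak plot has finite-dimensional range. *)
Lemma weak_diffeology_finer (E : diffeology R V) :
  vector_space_diffeology E -> finer weak_diffeology E.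
Proof.
move=> vE n U p wp; have oU := weak_plot_open wp.
have loc (x : {x | U x}) :
    exists N, [/\ open N, N (sval x), N `<=` U & plot E N p].
  case: x => x Ux /=; have [s sx] := weak_plot_locally_span wp Ux.
  pose N := [set y | span s (p y)]° `&` U.
  have oN : open N by apply: openI => //; exact: open_interior.
  exists N; split=> //; first by move=> y [].
  apply: (plot_of_weak_plot_span (s := s)) vE _ _.
    by apply: weak_plotS wp => // y [].
  by move=> y /[!inE] -[/interior_subset].
have [N NP] := choice loc.
have -> : U = \bigcup_x N x.
  apply/seteqP; split=> [x Ux|y [x _ Nxy]].
    by exists (exist _ x Ux) => //; have [] := NP (exist _ x Ux).
  by have [_ _ + _] := NP x; apply.
by apply: plot_bigcup => x; have [] := NP x.
Qed.

End WeakDiffeology.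

Theorem proposition3p4 (R : realType) (V : lmodType R) (D : diffeology R V)
    (hD : vector_space_diffeology D) :
  fine_diffeology D <-> smooth_linear_functionals D = linear_functionals V.
Proof.
split=> [[_ Dmin]|Dsmooth].
  apply/seteqP; split=> [l []//|l lin_l]; split=> // n U p Dp.
  pose L : {scalar V} := HB.pack l (GRing.isLinear.Build R V R *%R l lin_l).
  exact: (Dmin _ (weak_vector_space_diffeology V) _ _ _ Dp L).
split=> // E vE n U p Dp; apply: weak_diffeology_finer vE _ _ _ _ => L.
have [_ sL] : smooth_linear_functionals D L.
  by rewrite Dsmooth; exact: linearP.
exact: sL.
Qed.
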